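(* Let $A\subset\mathbb{R}^n$ be a nonempty and closed set not reduced to a singleton, and let $r>0$. Then $A$ is $r$-strongly convex if and only if $A$ is $r$-spherically supported and the topological interior of $A$ is nonempty.
   Context: $\|\cdot\|$ and $\langle\cdot,\cdot\rangle$ are the Euclidean norm and inner product on $\mathbb{R}^n$; $\overline{B}(y;\rho)$ is the closed ball of radius $\rho$ centered at $y$; $\operatorname{bdry}A$ is the topological boundary of $A$. Proximal normal cone: for $A$ nonempty and closed and $a\in A$, $N_A^P(a):=\{\zeta\in\mathbb{R}^n : \exists\,\sigma\ge 0,\ \langle\zeta,x-a\rangle\le\sigma\|x-a\|^2\ \text{for all }x\in A\}$. $r$-strongly convex: $A$ is the intersection of closed balls of the same radius $r>0$. $r$-spherically supported: for every $a\in\operatorname{bdry}A$ there exists a nonzero $\zeta_a\in N_A^P(a)$ such that $\left\langle\frac{\zeta_a}{\|\zeta_a\|},x-a\right\rangle\le-\frac{1}{2r}\|x-a\|^2$ for all $x\in A$; equivalently, $A\subset\overline{B}\left(a-r\frac{\zeta_a}{\|\zeta_a\|};r\right)$. *)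

(* Defs.v *)
From mathcomp Require Import all_boot all_order all_algebra.
From mathcomp Require Import all_classical all_reals all_analysis.

Set Implicit Arguments.
Unset Strict Implicit.
Unset Printing Implicit Defensive.
Import Order.TTheory GRing.Theory Num.Theory.
Import numFieldNormedType.Exports.
Local Open Scope classical_set_scope.
Local Open Scope ring_scope.

Definition dot (R : realType) (n : nat) (u v : 'rV[R]_n) : R :=
  \sum_(i < n) u 0 i * v 0 i.

(* The library's norm on 'rV[R]_n is the sup norm, hence [enorm]. The two norms
   are equivalent, so the library's topology on 'rV[R]_n (closed, closure,
   interior) is the Euclidean one. *)
Definition enorm (R : realType) (n : nat) (u : 'rV[R]_n) : R :=
  Num.sqrt (dot u u).

Definition bdry (T : topologicalType) (A : set T) : set T :=
  closure A `\` interior A.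

Definition proximal_normal_cone (R : realType) (n : nat) (A : set 'rV[R]_n)
    (a : 'rV[R]_n) : set 'rV[R]_n :=
  [set zeta | exists2 sigma : R, 0 <= sigma &
     forall x, A x -> dot zeta (x - a) <= sigma * enorm (x - a) ^+ 2].

(* [C] is the set of centers. It may be empty, so the whole space, as the empty
   intersection, is strongly convex for every radius. *)
Definition strongly_convex (R : realType) (n : nat) (r : R)
    (A : set 'rV[R]_n) : Prop :=
  exists C : set 'rV[R]_n, A = \bigcap_(c in C) closed_ball_ (@enorm R n) c r.

Definition spherically_supported (R : realType) (n : nat) (r : R)
    (A : set 'rV[R]_n) : Prop :=
  forall a, bdry A a -> exists zeta : 'rV[R]_n,
    [/\ zeta != 0, proximal_normal_cone A a zeta &
        forall x, A x ->
          dot ((enorm zeta)^-1 *: zeta) (x - a)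
            <= - (1 / (2 * r)) * enorm (x - a) ^+ 2].

(* Main.v *)
(* If A is an intersection of balls of radius r, the set K of centers c with
   A inside the ball B(c; r) is compact. At a boundary point a the maximum over
   K of |c - a| equals r, since otherwise a would be interior; the maximizer is
   the center of a supporting ball. The midpoint of two distinct points of A is
   interior because it lies uniformly deep inside every ball containing both.

   Conversely, for x outside A and z interior to A, let a be the last point of A
   on the segment from z to x. The supporting inequality at a, applied to z,
   gives <zeta_a, z - a> < 0, hence <zeta_a, x - a> > 0, so x lies outside the
   ball of radius r supporting A at a. *)
Require Import Defs.
From mathcomp Require Import all_boot all_order all_algebra.
From mathcomp Require Import all_classical all_reals all_analysis.
From mathcomp Require Import ring lra.
Import Order.TTheory GRing.Theory Num.Theory.
Import numFieldNormedType.Exports.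
Local Open Scope classical_set_scope.
Local Open Scope ring_scope.

(** * Algebra of the Euclidean inner product and norm *)

Lemma dotC {R : realType} {n : nat} (u v : 'rV[R]_n) : dot u v = dot v u.
Proof. by apply: eq_bigr => i _; rewrite mulrC. Qed.

Lemma dotDr {R : realType} {n : nat} (u v w : 'rV[R]_n) :
  dot u (v + w) = dot u v + dot u w.
Proof. by rewrite -big_split; apply: eq_bigr => i _; rewrite mxE mulrDr. Qed.

Lemma dotZr {R : realType} {n : nat} (k : R) (u v : 'rV[R]_n) :
  dot u (k *: v) = k * dot u v.
Proof. by rewrite mulr_sumr; apply: eq_bigr => i _; rewrite mxE mulrCA. Qed.

Lemma dotZl {R : realType} {n : nat} (k : R) (u v : 'rV[R]_n) :
  dot (k *: u) v = k * dot u v.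
Proof. by rewrite dotC dotZr dotC. Qed.

Lemma dot_sqrD {R : realType} {n : nat} (u v : 'rV[R]_n) :
  dot (u + v) (u + v) = dot u u + 2 * dot u v + dot v v.
Proof.
by rewrite dotDr dotC dotDr [dot (u + v) v]dotC dotDr (dotC v u); ring.
Qed.

Lemma dot_sqrZ {R : realType} {n : nat} (k : R) (u : 'rV[R]_n) :
  dot (k *: u) (k *: u) = k ^+ 2 * dot u u.
Proof. by rewrite dotZl dotZr mulrA expr2. Qed.

Lemma dot_sqrN {R : realType} {n : nat} (u : 'rV[R]_n) :
  dot (- u) (- u) = dot u u.
Proof. by rewrite -scaleN1r dot_sqrZ sqrrN expr1n mul1r. Qed.

Lemma dot_sqr_ge0 {R : realType} {n : nat} (u : 'rV[R]_n) : 0 <= dot u u.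
Proof. by apply: sumr_ge0 => i _; rewrite -expr2 sqr_ge0. Qed.

Lemma dot_sqr_coord {R : realType} {n : nat} (u : 'rV[R]_n) (i : 'I_n) :
  u 0 i ^+ 2 <= dot u u.
Proof.
rewrite /dot (bigD1 i)//= expr2 lerDl.
by apply: sumr_ge0 => j _; rewrite -expr2 sqr_ge0.
Qed.

Lemma dot_sqr_eq0 {R : realType} {n : nat} (u : 'rV[R]_n) :
  (dot u u == 0) = (u == 0).
Proof.
apply/eqP/eqP => [u0|->]; last by apply: big1 => i _; rewrite mxE mul0r.
apply/rowP => i; rewrite mxE; apply/eqP.
by rewrite -sqrf_eq0 eq_le sqr_ge0 andbT -u0 dot_sqr_coord.
Qed.

Lemma dot_sqr_gt0 {R : realType} {n : nat} (u : 'rV[R]_n) :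
  (0 < dot u u) = (u != 0).
Proof. by rewrite lt0r dot_sqr_ge0 andbT dot_sqr_eq0. Qed.

Lemma enorm_sqr {R : realType} {n : nat} (u : 'rV[R]_n) :
  enorm u ^+ 2 = dot u u.
Proof. by rewrite sqr_sqrtr ?dot_sqr_ge0. Qed.

Lemma enorm_gt0 {R : realType} {n : nat} (u : 'rV[R]_n) :
  (0 < enorm u) = (u != 0).
Proof. by rewrite sqrtr_gt0 dot_sqr_gt0. Qed.

(** Removing the square root turns ball membership into polynomial inequalities, within reach of
    [lra] and [nra]. *)
Lemma closed_ball_enormP {R : realType} {n : nat} (c x : 'rV[R]_n) (r : R) :
  0 <= r ->
  closed_ball_ (@enorm R n) c r x <-> dot (c - x) (c - x) <= r ^+ 2.
Proof.
move=> r0; rewrite -enorm_sqr /closed_ball_ /=.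
by rewrite ler_sqr // nnegrE // sqrtr_ge0.
Qed.

(** * Interior points of intersections of balls; compactness of the set of centers *)

Lemma continuous_dot_sqrB {R : realType} {n : nat} (a : 'rV[R]_n) :
  continuous (fun x : 'rV[R]_n => dot (x - a) (x - a)).
Proof.
apply: continuous_big => [|i _ x]; first exact: add_continuous.
have cf : continuous (fun y : 'rV[R]_n => (y - a) 0 i).
  have -> : (fun y : 'rV[R]_n => (y - a) 0 i) = (fun y => y 0 i - a 0 i).
    by apply/funext => y; rewrite !mxE.
  move=> y; apply: (@cvgB _ _ _ (nbhs y)); last exact: cvg_cst.
  exact: coord_continuous.
exact: (cvgM (cf x) (cf x)).
Qed.

(* Young's inequality [2 <u, v> <= s |u|^2 + |v|^2 / s] replaces the triangle
   inequality. *)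
Lemma interior_bigcap_balls {R : realType} {n : nat} (C : set 'rV[R]_n)
    (r m : R) (a : 'rV[R]_n) :
  0 < r -> m < r ^+ 2 -> (forall c, C c -> dot (c - a) (c - a) <= m) ->
  interior (\bigcap_(c in C) closed_ball_ (@enorm R n) c r) a.
Proof.
move=> r0 mr Cm.
(* A negative bound forces [C] to be empty, and the intersection is then the whole space. *)
have [m0|m0] := ltP m 0.
  apply: filterE => y c Cc.
  by have := le_lt_trans (Cm _ Cc) m0; rewrite ltNge dot_sqr_ge0.
(* Young bounds |c - y|^2 by (1 + s) m + (1 + 1/s) e. The choices of [s] and [e] make s r^2 and (1 +
   1/s) e each half of the gap r^2 - m, independently of [c]. *)
pose s := (r ^+ 2 - m) / (2 * r ^+ 2).
have r2 : 0 < r ^+ 2 by rewrite exprn_gt0.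
have s0 : 0 < s by rewrite divr_gt0 ?subr_gt0 ?mulr_gt0.
have sr : s * (2 * r ^+ 2) = r ^+ 2 - m by rewrite divfK // gt_eqF ?mulr_gt0.
pose e := (r ^+ 2 - m) / 2 / (1 + s^-1).
have is0 : 0 < s^-1 by rewrite invr_gt0.
have e0 : 0 < e by rewrite !divr_gt0 ?subr_gt0 ?addr_gt0.
have se : (1 + s^-1) * e = (r ^+ 2 - m) / 2.
  by rewrite mulrC divfK // gt_eqF ?addr_gt0.
have near_a : \forall y \near a, dot (y - a) (y - a) < e.
  apply: (@continuous_dot_sqrB _ _ a a [set t | t < e]).
  by apply: lt_nbhsl; rewrite subrr (eqP (_ : dot 0 0 == 0)) ?dot_sqr_eq0.
apply: filterS near_a => y ye c Cc.
apply/closed_ball_enormP; first exact: ltW.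
have -> : c - y = (c - a) + (- (y - a)) by rewrite opprB addrA subrK.
set u := c - a; set v := - (y - a); rewrite dot_sqrD.
have um : dot u u <= m by exact: Cm.
have ve : dot v v < e by rewrite dot_sqrN.
have Young : 2 * dot u v <= s * dot u u + s^-1 * dot v v.
  have := dot_sqr_ge0 (s *: u - v).
  rewrite dot_sqrD dot_sqrZ dot_sqrN -scaleN1r dotZr dotZl => h.
  rewrite -(ler_pM2l s0) mulrDr mulVKf ?gt_eqF //; nra.
have h1 : s * dot u u <= s * m by rewrite ler_pM2l.
have h2 : (1 + s^-1) * dot v v <= (1 + s^-1) * e.
  by rewrite ler_pM2l ?addr_gt0 // ltW.
have h3 : s * m <= s * r ^+ 2 by rewrite ler_pM2l // ltW.
lra.
Qed.

(** By symmetry of the distance this set is the intersection of the closed balls centered at the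
    points of [A]. It is thus closed, and a single point [x0] of [A] confines it to a box. *)
Lemma compact_centers {R : realType} {n : nat} (A : set 'rV[R]_n) (r : R) :
  A !=set0 -> 0 <= r ->
  compact [set c | A `<=` closed_ball_ (@enorm R n) c r].
Proof.
move=> [x0 Ax0] r0; set K := [set c | _].
have KE : K = \bigcap_(x in A)
    (fun c : 'rV[R]_n => dot (c - x) (c - x)) @^-1` [set t | t <= r ^+ 2].
  apply/seteqP; split => c Kc x Ax.
    by have /closed_ball_enormP := Kc x Ax; apply.
  by have /closed_ball_enormP := Kc x Ax; apply.
apply: (@subclosed_compact _ _
    [set c : 'rV[R]_n | forall i, `[x0 0 i - r, x0 0 i + r]%classic (c 0 i)]).
- rewrite KE; apply: closed_bigI => x _.
  apply: preimage_closed; last exact: closed_le.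
  by move=> c _; exact: continuous_dot_sqrB.
- apply: (@rV_compact R n (fun i => `[x0 0 i - r, x0 0 i + r]%classic)) => i.
  exact: segment_compact.
- move=> c /(_ _ Ax0) /(closed_ball_enormP _ _ _ r0) cr i /=.
  have := le_trans (dot_sqr_coord _ i) cr.
  rewrite -[leLHS]real_normK ?num_real // ler_sqr ?nnegrE //.
  rewrite !mxE ler_distlC in_itv /= => /andP[h1 h2].
  by apply/andP; split; lra.
Qed.

(** * Boundary and interior points of strongly convex sets; boundary points on segments *)

Lemma bdry_supporting_ball {R : realType} {n : nat} (A : set 'rV[R]_n)
    (r : R) (a : 'rV[R]_n) :
  closed A -> 0 < r -> strongly_convex r A -> bdry A a ->
  exists2 c, A `<=` closed_ball_ (@enorm R n) c r
           & dot (c - a) (c - a) = r ^+ 2.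
Proof.
move=> A_closed r0 [C AC] [cla nia].
have Aa : A a by exact: A_closed.
(* [C] need not be closed, so the maximum is taken over the larger set [K]; the balls centered in
   [K] still intersect inside [A]. *)
pose K := [set c | A `<=` closed_ball_ (@enorm R n) c r].
have CK : C `<=` K by move=> c Cc x; rewrite AC; apply.
have KA : interior (\bigcap_(c in K) closed_ball_ (@enorm R n) c r)
    `<=` interior A.
  by move=> y; apply: filterS; rewrite AC => x Kx c Cc; apply: Kx; exact: CK.
have [K0|K0] := pselect (K !=set0); last first.
  exfalso; apply/nia/KA; apply: (@interior_bigcap_balls _ _ _ _ 0) => //.
    by rewrite exprn_gt0.
  by move=> c Kc; case: K0; exists c.
have [//||c /set_mem Kc cmax] := @compact_EVT_max _ _
    (fun c : 'rV[R]_n => dot (c - a) (c - a)) K K0.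
- by apply: compact_centers; [exists a|exact: ltW].
- by apply: continuous_subspaceT; exact: continuous_dot_sqrB.
exists c => //; apply/eqP; rewrite eq_le; apply/andP; split.
  by apply/closed_ball_enormP; [exact: ltW|exact: Kc].
rewrite leNgt; apply/negP => cr; apply/nia/KA.
apply: (interior_bigcap_balls _ _ _ _ r0 cr) => d Kd.
by apply: cmax; rewrite inE.
Qed.

Lemma midpoint_interior {R : realType} {n : nat} (A : set 'rV[R]_n) (r : R)
    (x y : 'rV[R]_n) :
  0 < r -> strongly_convex r A -> A x -> A y -> x != y ->
  interior A (2^-1 *: (x + y)).
Proof.
move=> r0 [C ->] Ax Ay xy.
(* By the parallelogram law, |c - (x + y)/2|^2 is the mean of |c - x|^2 and |c - y|^2 minus |x -
   y|^2 / 4. *)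
pose m := r ^+ 2 - 4^-1 * dot (x - y) (x - y).
apply: (@interior_bigcap_balls _ _ _ _ m) => // [|c Cc].
  by rewrite /m ltrBlDr ltrDl mulr_gt0 // dot_sqr_gt0 subr_eq0.
have /closed_ball_enormP cx := Ax c Cc.
have /closed_ball_enormP cy := Ay c Cc.
have {}cx := cx (ltW r0); have {}cy := cy (ltW r0).
have -> : c - 2^-1 *: (x + y) = 2^-1 *: ((c - x) + (c - y)).
  by apply/rowP => i; rewrite !mxE; field.
have E : x - y = (c - y) + (- (c - x)) by rewrite opprB [RHS]addrC addrA subrK.
rewrite /m E; move: (c - x) (c - y) cx cy => p q cx cy.
rewrite dot_sqrZ !dot_sqrD dot_sqrN -(scaleN1r p) dotZr (dotC q p); lra.
Qed.

Lemma segment_meets_bdry {R : realType} {n : nat} (A : set 'rV[R]_n)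
    (z x : 'rV[R]_n) :
  closed A -> A z -> ~ A x ->
  exists t, [/\ 0 <= t, t < 1 & bdry A (z + t *: (x - z))].
Proof.
move=> A_closed Az nAx; pose f (t : R) := z + t *: (x - z).
have cf : continuous f.
  by move=> t; apply: cvgD; [exact: cvg_cst|apply: cvgZr_tmp; exact: cvg_id].
pose S := `[0, 1]%classic `&` f @^-1` A.
have S0 : S 0 by rewrite /S /= /f scale0r addr0 in_itv /= lexx ler01.
have cS : compact S.
  apply: compact_closedI; first exact: segment_compact.
  by apply: preimage_closed => // t _; exact: cf.
have idc : {within S, continuous (@id R)}.
  by apply: continuous_subspaceT => t; exact: cvg_id.
have [t /set_mem [/= t01 At] tmax] := compact_EVT_max (ex_intro _ 0 S0) cS idc.
move: t01; rewrite in_itv /= => /andP[t0 t1].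
have {}t1 : t < 1.
  rewrite lt_neqAle t1 andbT; apply/eqP => t1'; apply: nAx.
  by move: At; rewrite /f t1' scale1r addrC subrK.
exists t; split => //; split; first exact: subset_closure.
(* If [f t] were interior, some parameter [u] with t < u < 1 would still give a point of [A],
   against the maximality of [t]. *)
have /cvg_at_right_filter cft := cf t; move=> /cft Af.
have [u [[Au tu] u1]] : exists u, (A (f u) /\ t < u) /\ u < 1.
  apply: (@filter_ex _ t^'+); apply: filterI; last exact: nbhs_right_lt.
  by apply: filterI; [exact: Af|exact: nbhs_right_gt].
suff /tmax : u \in S by rewrite leNgt tu.
by rewrite inE; split => //=; rewrite in_itv /= (ltW u1) (le_trans t0 (ltW tu)).
Qed.

(** * The two implications and the theorem *)

Lemma strongly_convex_spherically_supported {R : realType} {n : nat}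
    (A : set 'rV[R]_n) (r : R) :
  closed A -> 0 < r -> strongly_convex r A -> spherically_supported r A.
Proof.
move=> A_closed r0 scA a bda.
have [c Ac cr] := bdry_supporting_ball _ _ _ A_closed r0 scA bda.
have ecr : enorm (a - c) = r.
  by rewrite /enorm -opprB dot_sqrN cr sqrtr_sqr gtr0_norm.
(* This is |c - x|^2 <= r^2 = |c - a|^2, expanded around [a]. *)
have key x : A x -> dot (a - c) (x - a) <= - (1 / 2) * dot (x - a) (x - a).
  move=> Ax; have /closed_ball_enormP := Ac x Ax => /(_ (ltW r0)).
  have -> : c - x = - ((a - c) + (x - a)).
    by rewrite [a - c + _]addrC addrA subrK opprB.
  rewrite dot_sqrN dot_sqrD -cr -(opprB a c) dot_sqrN; lra.
exists (a - c); split.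
- by rewrite -enorm_gt0 ecr.
- exists 0 => // x /key; have := dot_sqr_ge0 (x - a); rewrite mul0r; lra.
- move=> x /key h; rewrite ecr dotZl enorm_sqr -(ler_pM2l r0) mulVKf ?gt_eqF //.
  apply: (le_trans h); rewrite le_eqVlt; apply/orP; left; apply/eqP.
  by field; rewrite gt_eqF.
Qed.

Lemma spherically_supported_strongly_convex {R : realType} {n : nat}
    (A : set 'rV[R]_n) (r : R) :
  closed A -> 0 < r -> spherically_supported r A -> interior A !=set0 ->
  strongly_convex r A.
Proof.
move=> A_closed r0 ssA [z iAz].
have Az : A z by exact: interior_subset.
exists [set c | A `<=` closed_ball_ (@enorm R n) c r].
apply/seteqP; split => [x Ax c|x Bx]; first exact.
apply: contrapT => nAx.
have [t [t0 t1 bda]] := segment_meets_bdry _ _ _ A_closed Az nAx.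
set a := z + _ in bda.
have [zeta [zeta0 _ supp]] := ssA a bda.
set u := (enorm zeta)^-1 *: zeta in supp.
have uu : dot u u = 1.
  by rewrite dot_sqrZ -enorm_sqr -exprMn mulVf ?expr1n // gt_eqF ?enorm_gt0.
have supp' y : A y -> 2 * r * dot u (y - a) + dot (y - a) (y - a) <= 0.
  move=> /supp; rewrite enorm_sqr -(@ler_pM2l _ (2 * r)) ?mulr_gt0 //.
  by rewrite mulNr mulrN mulrA mul1r mulfV ?mul1r ?gt_eqF ?mulr_gt0 //; lra.
(* With this expansion, [supp'] says that [A] lies in the ball of radius [r] centered at
   [a - r *: u]. *)
have distE y : dot (a - r *: u - y) (a - r *: u - y)
    = dot (y - a) (y - a) + 2 * r * dot u (y - a) + r ^+ 2.
  have -> : a - r *: u - y = - ((y - a) + r *: u).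
    by rewrite opprD opprB addrAC.
  by rewrite dot_sqrN dot_sqrD dot_sqrZ uu dotZr (dotC (y - a)); ring.
have Kc : A `<=` closed_ball_ (@enorm R n) (a - r *: u) r.
  move=> y /supp' h; apply/closed_ball_enormP; first exact: ltW.
  by rewrite distE; lra.
have /closed_ball_enormP := Bx _ Kc => /(_ (ltW r0)); rewrite distE => hx.
have az : z - a != 0.
  by rewrite subr_eq0; apply: contra_notN bda.2 => /eqP <-.
have hz := supp' z Az.
have zz : 0 < dot (z - a) (z - a) by rewrite dot_sqr_gt0.
(* The vectors from [a] to [x] and from [z] to [a] are parallel, so <u, x - a> and <u, z - a> can be
   compared. *)
have xa : t *: (x - a) = (1 - t) *: (a - z).
  by apply/rowP => i; rewrite /a !mxE; ring.
have hd : t * dot u (x - a) = - (1 - t) * dot u (z - a).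
  by rewrite -dotZr xa -(opprB z a) scalerN -scaleNr dotZr.
(* [hz] and [zz] give <u, z - a> < 0, so [hd] and t < 1 give <u, x - a> > 0, which contradicts
   [hx]. *)
have := dot_sqr_ge0 (x - a); nra.
Qed.

Theorem theorem1p1 (R : realType) (n : nat) (A : set 'rV[R]_n) (r : R)
  (A_nonempty : A !=set0) (A_closed : closed A)
  (A_not_singleton : forall a : 'rV[R]_n, A <> [set a]) (r_gt0 : 0 < r) :
  strongly_convex r A <-> spherically_supported r A /\ interior A !=set0.
Proof.
split=> [scA|[ssA iA]]; last exact: spherically_supported_strongly_convex.
split; first exact: strongly_convex_spherically_supported.
have [x Ax] := A_nonempty.
have [y [Ay xy]] : exists y, A y /\ x != y.
  apply: contrapT => noy; apply: (A_not_singleton x).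
  apply/seteqP; split => [y Ay|_ ->//].
  apply: contrapT => yx; apply: noy; exists y; split => //.
  by apply/eqP => /esym.
by exists (2^-1 *: (x + y)); exact: (midpoint_interior _ r).
Qed.
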